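(* Let $Q$ be the linearly oriented quiver $1\to 2\to\cdots\to n$ of type $\mathbb{A}_n$, with arrows $\alpha_i:i\to i+1$ for $1\le i\le n-1$, and let $A=\mathbb{F}Q/I$ be a Nakayama algebra, where $I$ is generated by the minimal relations $\alpha_{i_l}\alpha_{i_l+1}\cdots\alpha_{i_l+p_l}$, $1\le l\le k$. Then the number $|\mathrm{Ind}(A)|$ of isomorphism classes of indecomposable $A$-modules is \[ |\mathrm{Ind}(A)|=\sum_{l=1}^{k+1}(i_l-i_{l-1})(i_l+p_l)-\frac{n(n-1)}{2}, \] with the conventions $i_0=p_{k+1}=0$ and $i_{k+1}=n$.
   Context: $\mathbb{F}$ is an algebraically closed field and $n\ge 3$. The relation $R_l=\alpha_{i_l}\alpha_{i_l+1}\cdots\alpha_{i_l+p_l}$ is the path of length $p_l+1$ starting at vertex $i_l$ and ending at vertex $i_l+p_l+1$. The parameters satisfy $k\ge 0$, $1\le i_1<i_2<\cdots<i_k$, $p_l\ge 1$ and $i_l+p_l\le n-1$ for $1\le l\le k$; minimality of the set of relations means that no relation is a subpath of another, i.e. $i_1+p_1<i_2+p_2<\cdots<i_k+p_k$. $A$-modules are finite-dimensional and are identified with finite-dimensional representations of $Q$ over $\mathbb{F}$ (vector spaces $V_i$ and linear maps $V_i\to V_{i+1}$) satisfying the relations in $I$. *)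

(* Defs.v *)
From HB Require Import structures.
From mathcomp Require Import all_boot all_order all_algebra.

Set Implicit Arguments.
Unset Strict Implicit.
Unset Printing Implicit Defensive.

Import GRing.Theory.
Local Open Scope ring_scope.

Record quiver := Quiver {
  vertex : finType;
  arrow : finType;
  source : arrow -> vertex;
  target : arrow -> vertex
}.

(* Paths are written from left to right: [pcons a w] runs along [a] first. *)
Inductive qpath (Q : quiver) : vertex Q -> vertex Q -> Type :=
| pnil (x : vertex Q) : qpath x x
| pcons (a : arrow Q) (y : vertex Q) (w : qpath (target a) y) :
    qpath (source a) y.

Fixpoint path_arrows (Q : quiver) (x y : vertex Q) (w : qpath x y) :
    seq (arrow Q) :=
  match w with
  | pnil _ => [::]
  | pcons a _ w' => a :: path_arrows w'
  end.

(* [vectType F] makes all representations finite-dimensional. *)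
Record rep (F : fieldType) (Q : quiver) := Rep {
  space :> vertex Q -> vectType F;
  amap : forall a : arrow Q, 'Hom(space (source a), space (target a))
}.

Fixpoint pmap_rep (F : fieldType) (Q : quiver) (M : rep F Q)
    (x y : vertex Q) (w : qpath x y) : 'Hom(M x, M y) :=
  match w in qpath x0 y0 return 'Hom(M x0, M y0) with
  | pnil _ => \1%VF
  | pcons a _ w' => (pmap_rep M w' \o amap M a)%VF
  end.

Definition rep_iso (F : fieldType) (Q : quiver) (M N : rep F Q) : Prop :=
  exists f : forall x : vertex Q, 'Hom(M x, N x),
    (forall x : vertex Q, bijective (f x)) /\
    (forall a : arrow Q,
       (f (target a) \o amap M a = amap N a \o f (source a))%VF).

Definition rep_sum (F : fieldType) (Q : quiver) (M N : rep F Q) : rep F Q :=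
  @Rep F Q (fun x => (M x * N x)%type)
    (fun a => linfun (fun u : M (source a) * N (source a) =>
                        (amap M a u.1, amap N a u.2))).

Definition rep_zero (F : fieldType) (Q : quiver) (M : rep F Q) : Prop :=
  forall (x : vertex Q) (u : M x), u = 0.

Definition indecomposable (F : fieldType) (Q : quiver) (M : rep F Q) : Prop :=
  ~ rep_zero M /\
  forall M1 M2 : rep F Q,
    rep_iso M (rep_sum M1 M2) -> rep_zero M1 \/ rep_zero M2.

Definition num_iso_classes (F : fieldType) (Q : quiver)
    (P : rep F Q -> Prop) (N : nat) : Prop :=
  exists M : 'I_N -> rep F Q,
    [/\ forall s : 'I_N, P (M s),
        forall s t : 'I_N, rep_iso (M s) (M t) -> s = t
      & forall M' : rep F Q, P M' -> exists s : 'I_N, rep_iso M' (M s)].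

Lemma linear_target_proof (n : nat) (a : 'I_n.-1) : (a.+1 < n)%N.
Proof. by rewrite -ltn_predRL. Qed.

(* The quiver 1 -> 2 -> ... -> n. Ordinals start at 0, so [x : 'I_n] stands
   for the vertex x + 1, and [a : 'I_n.-1] for the arrow alpha_(a + 1). *)
Definition linear_quiver (n : nat) : quiver :=
  @Quiver 'I_n 'I_n.-1
    (fun a => widen_ord (leq_pred n) a)
    (fun a => Ordinal (linear_target_proof a)).

(* The labels [j] of the successive arrows alpha_j of a path. *)
Definition path_labels (n : nat) (x y : vertex (linear_quiver n))
    (w : qpath x y) : seq nat :=
  [seq (nat_of_ord a).+1 | a : 'I_n.-1 <- path_arrows w].

(* A representation is bound by the ideal I as soon as it kills the generators
   alpha_(i l) ... alpha_(i l + p l) of I, for 1 <= l <= k. *)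
Definition nakayama_module (F : fieldType) (n k : nat) (i p : nat -> nat)
    (M : rep F (linear_quiver n)) : Prop :=
  forall l : nat, (1 <= l <= k)%N ->
  forall (x y : vertex (linear_quiver n)) (w : qpath x y),
    path_labels w = iota (i l) (p l).+1 -> pmap_rep M w = 0.

(* Main.v *)
Require Import Defs.
From HB Require Import structures.
From mathcomp Require Import all_boot all_order all_algebra.
From mathcomp Require Import zify ring.

Set Implicit Arguments.
Unset Strict Implicit.
Unset Printing Implicit Defensive.

Import Order.TTheory GRing.Theory Num.Theory.
Local Open Scope ring_scope.

(** Over the linear quiver the indecomposable representations are the interval
    representations: a line at each vertex of [lo, hi], identities between
    them, zero elsewhere.  Counting the modules then means counting the
    intervals that contain no relation.

    To see that an indecomposable M is an interval, let lo be the first vertex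
    of its support, v a nonzero vector of M lo, and hi the last vertex at which
    the transport of v along the arrows is nonzero.  The transported vectors
    [w x] define a morphism from the interval representation on [lo, hi] to M.
    Choose a linear form on M hi with value 1 on [w hi] and pull it back along
    the arrows: the forms so obtained define a morphism from M to the interval.
    Compatibility at the left end of the interval is free because M vanishes
    before lo, and this is why v is taken at the first vertex of the support.
    The composite is the identity of the interval, so that the interval is a
    direct summand of M ([retract_sum]), hence all of M
    ([indecomposable_retract]).  This gives [indecomposable_interval].

    Conversely, an interval representation has a simple socle: any nonzero
    vector is carried along the arrows to a nonzero vector at hi, where the
    space is a line, so two nonzero subrepresentations cannot be in direct sum
    ([interval_indecomposable]).  The support determines the interval
    ([interval_iso_eq]).

    Finally, an interval is a module over the quotient exactly when it does not
    contain both ends of a relation ([nakayama_interval]).  Since the starts and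
    the ends of the relations increase together, an interval that starts after
    vertex i_(l-1) and no later than i_l has to avoid only the l-th relation,
    or no relation at all when l = k + 1: its last vertex ranges up to i_l + p_l ([admissible_range]).  Summing the
    resulting lengths i_l + p_l - lo, with vertices numbered from 0, over all
    starts lo yields the formula, the term n (n - 1) / 2 being the sum of the
    lo. *)

(** * Morphisms, kernels and retracts of representations *)

Section Rep.
Variables (F : fieldType) (Q : quiver).
Implicit Types M N : rep F Q.

Definition rep_hom M N (f : forall x : vertex Q, 'Hom(M x, N x)) : Prop :=
  forall a : arrow Q,
    (f (target a) \o amap M a = amap N a \o f (source a))%VF.

Lemma rep_homP M N (f : forall x : vertex Q, 'Hom(M x, N x)) :
  (forall a u, f (target a) (amap M a u) = amap N a (f (source a) u)) ->
  rep_hom f.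
Proof. by move=> h a; apply/lfunP => u; rewrite !comp_lfunE h. Qed.

Lemma rep_homE M N (f : forall x : vertex Q, 'Hom(M x, N x)) :
  rep_hom f ->
  forall a u, f (target a) (amap M a u) = amap N a (f (source a) u).
Proof. by move=> h a u; have /lfunP/(_ u) := h a; rewrite !comp_lfunE. Qed.

Lemma rep_hom_path M N (f : forall x : vertex Q, 'Hom(M x, N x)) x y
    (w : qpath x y) (u : M x) : rep_hom f ->
  f y (pmap_rep M w u) = pmap_rep N w (f x u).
Proof.
move=> /rep_homE fE; elim: w u => [z|a z w IHw] u /=.
  by rewrite !id_lfunE.
by rewrite !comp_lfunE IHw fE.
Qed.

Lemma linfunE (U V : vectType F) (f : U -> V) (u : U) :
  linear f -> linfun f u = f u.
Proof.
move=> f_lin.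
pose L : {linear U -> V} := HB.pack f (GRing.isLinear.Build F U V _ f f_lin).
exact: (lfunE L).
Qed.

Lemma amap_sum M N a u :
  amap (rep_sum M N) a u = (amap M a u.1, amap N a u.2).
Proof. by rewrite linfunE // => c [u1 u2] [v1 v2]; rewrite /= !linearP. Qed.

Lemma pmap_sum M N x y (w : qpath x y) (u : rep_sum M N x) :
  pmap_rep (rep_sum M N) w u = (pmap_rep M w u.1, pmap_rep N w u.2).
Proof.
elim: w u => [z|a z w IHw] u /=; first by rewrite !id_lfunE; case: u.
by rewrite !comp_lfunE [LHS]IHw amap_sum.
Qed.

(** Since vanishing is read off from finitely many dimensions it is decidable,
    so that indecomposability can be proved by contradiction. *)
Lemma rep_zeroP M : reflect (rep_zero M) [forall x, \dim {:M x} == 0%N].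
Proof.
apply: (iffP forallP) => [M0 x u|M0 x].
  have := M0 x; rewrite dimv_eq0 => /eqP e.
  by apply/eqP; rewrite -memv0 -e memvf.
rewrite dimv_eq0 -subv0; apply/subvP => u _; rewrite (M0 x u); exact: mem0v.
Qed.

Lemma rep_nonzeroP M : ~ rep_zero M <-> exists x (u : M x), u <> 0.
Proof.
split=> [/rep_zeroP/forallPn[x nz_x]|[x [u nz_u]] M0]; last exact/nz_u/M0.
by exists x, (vpick {:M x}); apply/eqP; rewrite vpick0 -dimv_eq0.
Qed.

Definition ker_rep M N (g : forall x : vertex Q, 'Hom(M x, N x)) : rep F Q :=
  @Rep F Q (fun x => subvs_of (lker (g x)))
    (fun a => (linfun (vsproj (lker (g (target a))))
               \o amap M a \o linfun (@vsval _ _ (lker (g (source a)))))%VF).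

(** The splitting lemma: if g \o s is the identity, then [u - s (g u)] is the
    component of [u] in the kernel of g. *)
Lemma retract_sum M N (s : forall x : vertex Q, 'Hom(N x, M x))
    (g : forall x : vertex Q, 'Hom(M x, N x)) :
  rep_hom s -> rep_hom g -> (forall x, cancel (s x) (g x)) ->
  rep_iso M (rep_sum N (ker_rep g)).
Proof.
move=> /rep_homE sE gH sK; have gE := rep_homE gH.
pose k x u : subvs_of (lker (g x)) := vsproj _ (u - s x (g x u)).
have kE x u : vsval (k x u) = u - s x (g x u).
  by rewrite vsprojK // memv_ker linearB /= sK subrr.
pose f x : 'Hom(M x, rep_sum N (ker_rep g) x) :=
  linfun (fun u => (g x u, k x u)).
have fE x u : f x u = (g x u, k x u).
  rewrite linfunE // => c u1 u2; congr pair; first exact: linearP.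
  apply: val_inj; rewrite /= !kE linearP linearP scalerBr opprD.
  by rewrite addrACA -scalerN.
exists f; split=> [x|].
  exists (fun v => s x v.1 + vsval v.2) => [u|[v1 v2]].
    by rewrite fE /= kE addrC subrK.
  rewrite fE /=; have gv2 : g x (vsval v2) = 0.
    by apply/eqP; rewrite -memv_ker subvsP.
  congr pair; first by rewrite linearD /= sK gv2 addr0.
  by apply: val_inj; rewrite /= kE linearD /= sK gv2 addr0 addrC addKr.
apply: rep_homP => a u; rewrite amap_sum !fE gE /=; congr pair.
apply: val_inj; rewrite /= !comp_lfunE !lfunE /= kE.
rewrite vsprojK; first by rewrite kE linearB /= gE sE.
by rewrite memv_ker gE kE linearB /= sK subrr linear0.
Qed.

(** The kernel of the retraction is a complement of N, so it vanishes and the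
    retraction is injective. *)
Lemma indecomposable_retract M N (s : forall x : vertex Q, 'Hom(N x, M x))
    (g : forall x : vertex Q, 'Hom(M x, N x)) :
  rep_hom s -> rep_hom g -> (forall x, cancel (s x) (g x)) ->
  ~ rep_zero N -> indecomposable M -> rep_iso M N.
Proof.
move=> sH gH sK nzN [_ /(_ _ _ (retract_sum sH gH sK)) [//|ker0]].
exists g; split=> // x; exists (s x) => // u; apply/eqP.
rewrite -subr_eq0; apply/eqP.
have uker : s x (g x u) - u \in lker (g x).
  by rewrite memv_ker linearB /= sK subrr.
by rewrite -(vsprojK uker) [vsproj _ _](ker0 x) linear0.
Qed.

End Rep.

(** * Transport along the arrows *)

(** If every vertex is the target of at most one arrow, and the vertices have
    distinct ranks that increase along arrows, then a family of values can be
    computed vertex by vertex from the values [d] at the vertices without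
    incoming arrow.  The lemma serves for
    pushing a vector forward and, with sources and targets exchanged, for
    pulling a linear form back.  The induction on the rank extends a partial
    solution by one vertex at a time, which avoids transporting elements along
    equalities between vertices. *)
Lemma section_along_arrows (X A : finType) (s t : A -> X) (r : X -> nat)
    (T : X -> Type) (d : forall x, T x) (step : forall a, T (s a) -> T (t a)) :
  injective t -> injective r -> (forall a, r (s a) < r (t a))%N ->
  exists w : forall x, T x,
    (forall a, w (t a) = step a (w (s a))) /\
    (forall x, x \notin codom t -> w x = d x).
Proof.
move=> t_inj r_inj r_lt.
have [m le_m] : exists m, forall x, (r x < m)%N.
  by exists (\max_x r x).+1 => x; rewrite ltnS; exact: leq_bigmax.
suff [w [wE w_d]] : exists w : forall x, T x,
    (forall a, (r (t a) < m)%N -> w (t a) = step a (w (s a))) /\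
    (forall x, x \notin codom t -> w x = d x).
  by exists w; split=> // a; apply: wE.
elim: m {le_m} => [|m [w [wE w_d]]]; first by exists d.
have [a /eqP ra|no_a] := pickP (fun a => r (t a) == m); last first.
  exists w; split=> // a; rewrite ltnS leq_eqVlt => /orP[|/wE //].
  by have := no_a a; rewrite /= => ->.
exists (dfwith w (step a (w (s a)))); split=> [b|x x_out]; last first.
  rewrite dfwith_out ?w_d //; apply: contraNneq x_out => <-.
  exact: codom_f.
rewrite ltnS leq_eqVlt => /orP[/eqP rb|rb].
  have {rb} -> : b = a by apply/t_inj/r_inj; rewrite rb.
  rewrite dfwith_in dfwith_out //; apply/eqP => e.
  by have := r_lt a; rewrite e ltnn.
rewrite !dfwith_out ?wE //; apply/eqP => e; last by rewrite -e ra ltnn in rb.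
by have := r_lt b; rewrite -e ra ltnNge ltnW.
Qed.

(** * Interval representations of the linear quiver *)

Section Linear.
Variables (F : fieldType) (n : nat).

Notation lq := (linear_quiver n).

Lemma path_labels_iota (x y : vertex lq) (w : qpath x y) :
  (x <= y)%N /\ path_labels w = iota x.+1 (y - x).
Proof.
elim: w => [z|a z w [le_z IHw]]; first by rewrite subnn.
rewrite /= in le_z *; split; first exact: ltnW.
rewrite /path_labels /= -[map _ _]/(path_labels w) IHw subnS.
by rewrite -[(z - a)%N]prednK ?subn_gt0.
Qed.

Lemma linear_path (x y : vertex lq) : (x <= y)%N -> inhabited (qpath x y).
Proof.
move=> le_xy; have [m] : exists m, m = (y - x)%N by eexists.
elim: m x le_xy => [|m IHm] x le_xy e.
  have -> : y = x by apply: val_inj => /=; lia.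
  by split; exact: pnil.
have lt_x : (x < n.-1)%N by have := ltn_ord y; lia.
have -> : x = @source lq (Ordinal lt_x) by exact: val_inj.
have [||w] := IHm (@target lq (Ordinal lt_x)); [by move=> /=; lia..|].
by split; exact: pcons w.
Qed.

(** The dimension at [x] is the truth value of [lo <= x <= hi], so the spaces
    are rows of size 0 or 1 and no case distinction enters the types. *)
Definition interval_rep (lo hi : nat) : rep F lq :=
  @Rep F lq (fun x => 'rV[F]_(lo <= nat_of_ord x <= hi)%N : vectType F)
    (fun a => linfun (mulmxr (const_mx 1))).

(** On rows of size 0 or 1 this is the coordinate, with value 0 on the zero
    space; it allows the two sizes to be treated by the same formulas. *)
Definition coef d (u : 'rV[F]_d) : F := \sum_j u 0 j.

Lemma coef_scalar d : scalar (@coef d).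
Proof.
move=> c u v; rewrite /coef mulr_sumr -big_split.
by apply: eq_bigr => j _; rewrite !mxE.
Qed.

Lemma const_mx0 d : const_mx 0 = 0 :> 'rV[F]_d.
Proof. by apply/rowP => j; rewrite !mxE. Qed.

Lemma coef0 d : coef (0 : 'rV_d) = 0.
Proof. by rewrite /coef big1 // => j _; rewrite mxE. Qed.

Lemma coef_const (b : bool) c : b -> coef (const_mx c : 'rV_b) = c.
Proof. by case: b => // _; rewrite /coef big_ord1 mxE. Qed.

Lemma const_coef (b : bool) (u : 'rV[F]_b) : const_mx (coef u) = u.
Proof.
case: b u => u; apply/rowP => - [[]] // ?; rewrite mxE /coef big_ord1.
by congr (u _ _); apply: val_inj.
Qed.

Lemma row_bool0 (b : bool) (u : 'rV[F]_b) : b = false -> u = 0.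
Proof. by move=> e; move: u; rewrite e => u; apply: thinmx0. Qed.

Lemma amap_interval lo hi a (u : interval_rep lo hi (@source lq a)) :
  amap (interval_rep lo hi) a u = const_mx (coef u).
Proof.
rewrite lfunE /=; apply/rowP => j; rewrite !mxE.
by apply: eq_bigr => k _; rewrite mxE mulr1.
Qed.

Lemma pmap_interval lo hi (x y : vertex lq) (w : qpath x y)
    (u : interval_rep lo hi x) :
  (lo <= x)%N -> (y <= hi)%N ->
  pmap_rep (interval_rep lo hi) w u = const_mx (coef u).
Proof.
elim: w u => [z|a z w IHw] u lo_x y_hi; first by rewrite id_lfunE const_coef.
have [le_z _] := path_labels_iota w; rewrite /= in lo_x le_z *.
rewrite comp_lfunE IHw //=; last by lia.
by rewrite amap_interval coef_const //; lia.
Qed.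

Lemma interval_nonzero lo hi (x : vertex lq) :
  (lo <= x <= hi)%N <-> exists u : interval_rep lo hi x, u <> 0.
Proof.
split=> [x_in|[u nz_u]]; last first.
  by apply: contra_notT nz_u => /negbTE; exact: row_bool0.
exists (const_mx 1) => /(congr1 (@coef _)).
by rewrite coef_const // coef0 => /eqP; rewrite oner_eq0.
Qed.

(** The socle at [hi] is a line, and it meets every nonzero summand. *)
Lemma interval_indecomposable (lo hi : 'I_n) :
  (lo <= hi)%N -> indecomposable (interval_rep lo hi).
Proof.
move=> lo_hi; split=> [z|M1 M2 [f [f_bij fH]]].
  have /interval_nonzero[u] : (lo <= (lo : vertex lq) <= hi)%N by rewrite leqnn.
  by case; apply: z.
have reach (x : vertex lq) (v : rep_sum M1 M2 x) : v <> 0 ->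
    exists w : qpath x hi, pmap_rep (rep_sum M1 M2) w v <> 0.
  move=> nz_v; have [g fK gK] := f_bij x.
  have /interval_nonzero x_in : exists u : interval_rep lo hi x, u <> 0.
    by exists (g v) => gv0; apply: nz_v; rewrite -(gK v) gv0 linear0.
  have /andP[lo_x x_hi] := x_in.
  have [w] := @linear_path x hi x_hi; exists w => pv0; apply: nz_v.
  rewrite -(gK v); suff -> : g v = 0 by rewrite linear0.
  have := rep_hom_path w (g v) fH; rewrite gK pv0 pmap_interval // => e.
  have [h hK _] := f_bij hi.
  have {e} : const_mx (coef (g v)) = 0 :> interval_rep lo hi hi.
    by rewrite -(hK (const_mx _)) e -[in RHS](hK 0) linear0.
  move=> /(congr1 (@coef _)); rewrite coef_const ?lo_hi ?leqnn // coef0 => c0.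
  by rewrite -[g v]const_coef c0.
(* The space at [hi] is a line, so M1 and M2 cannot both be nonzero there. *)
have in1 (v1 : M1 hi) (v2 : M2 hi) : v1 <> 0 -> v2 = 0.
  have [g fK gK] := f_bij hi; move=> nz_v1.
  pose c := coef (g (0, v2)) / coef (g (v1, 0)).
  have c1 : coef (g (v1, 0)) != 0.
    apply: contra_notN nz_v1 => /eqP c0.
    have e : g (v1, 0) = 0 by rewrite -[LHS]const_coef c0.
    by have := gK (v1, 0); rewrite e linear0 => -[].
  have e : g (0, v2) = c *: g (v1, 0).
    rewrite -[LHS]const_coef -[g (v1, 0)]const_coef; apply/rowP => j.
    by rewrite !mxE divfK.
  have := gK (0, v2); rewrite e linearZ /= gK => -[_ <-]; exact: scaler0.
have [/rep_zeroP|/rep_zeroP/rep_nonzeroP[x [u1 nz_u1]]] :=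
  boolP [forall x, \dim {:M1 x} == 0%N]; first by left.
right; apply/rep_zeroP; apply: contraT => /rep_zeroP/rep_nonzeroP[y [u2 nz_u2]].
have [|w1] := reach x (u1, 0); first by case.
rewrite pmap_sum /= linear0 => nz1.
have [|w2] := reach y (0, u2); first by case.
rewrite pmap_sum /= linear0 => nz2.
case: nz2; rewrite (in1 (pmap_rep M1 w1 u1) (pmap_rep M2 w2 u2)) // => e.
by apply: nz1; rewrite e.
Qed.

(** Isomorphisms preserve the support, which determines the two ends. *)
Lemma interval_iso_eq lo hi lo' hi' :
  (lo <= hi < n)%N -> (lo' <= hi' < n)%N ->
  rep_iso (interval_rep lo hi) (interval_rep lo' hi') ->
  (lo = lo') /\ (hi = hi').
Proof.
move=> /andP[lo_hi hi_n] /andP[lo_hi' hi_n'] [f [f_bij _]].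
have supp m : (m < n)%N -> (lo <= m <= hi)%N = (lo' <= m <= hi')%N.
  move=> lt_m; pose x : vertex lq := Ordinal lt_m; have [g fK gK] := f_bij x.
  apply/idP/idP => /(interval_nonzero _ _ x)[u nz_u];
    apply/(interval_nonzero _ _ x).
    exists (f x u) => fu0; apply: nz_u; apply: (can_inj fK).
    by rewrite fu0 linear0.
  by exists (g u) => gu0; apply: nz_u; rewrite -(gK u) gu0 linear0.
have := supp lo; have := supp hi; have := supp lo'; have := supp hi'.
lia.
Qed.

Lemma dual_vector (V : vectType F) (v : V) :
  v != 0 -> exists phi : 'Hom(V, F^o), phi v = 1.
Proof.
move=> nz_v; exists (linfun (fun u => coord [tuple v] 0 u : F^o)).
rewrite linfunE => [|c u1 u2]; last by rewrite linearD linearZ.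
by have /(coord_free 0 0) := etrans (seq1_free v) nz_v.
Qed.

(** * Indecomposable representations are intervals *)

(** The interval is generated by a vector [v] at the first vertex [lo] of the
    support.  It is a retract of M through the forms [phi x], because [phi x]
    has value 1 on the transport [w x] of [v] for [lo <= x <= hi]. *)
Lemma indecomposable_interval (M : rep F lq) : indecomposable M ->
  exists lo hi : 'I_n, (lo <= hi)%N /\ rep_iso M (interval_rep lo hi).
Proof.
move=> M_ind; have [nzM _] := M_ind.
pose supp := [pred x : 'I_n | \dim {:M x} != 0%N].
have suppP (x : 'I_n) (u : M x) : ~~ supp x -> u = 0.
  rewrite negbK dimv_eq0 => /eqP e; apply/eqP.
  by rewrite -memv0 -e memvf.
have [x0 supp_x0] : exists x, supp x.
  apply/existsP; apply: contra_notT nzM => /existsPn no x u; exact: suppP.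
case: (arg_minnP (fun x : 'I_n => nat_of_ord x) supp_x0) => lo supp_lo lo_min.
have {supp_x0 x0} below (x : 'I_n) (u : M x) : (x < lo)%N -> u = 0.
  by move=> lt_x; apply: suppP; apply: contraL lt_x => /lo_min; rewrite -leqNgt.
have [v nz_v] : exists v : M lo, v != 0.
  exists (vpick {:M lo}); rewrite vpick0 -dimv_eq0; exact: supp_lo.
have tgt_inj : injective (@target lq).
  by move=> a b /(congr1 val) /= [] /val_inj.
have src_inj : injective (@source lq).
  by move=> a b /(congr1 val) /= /val_inj.
pose at_lo (x : vertex lq) : M x := dfwith (fun x => 0) v x.
(* The values up to [lo] are prescribed, so that the transport starts from [v]
   even when [lo] has an incoming arrow. *)
have [w [wE w_min]] : exists w : forall x : vertex lq, M x,
    (forall a : arrow lq,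
       w (target a) = if (@target lq a <= lo)%N then at_lo (target a)
                      else amap M a (w (source a))) /\
    (forall x, x \notin codom (@target lq) -> w x = at_lo x).
  apply: (@section_along_arrows _ _ (@source lq) (@target lq) (@nat_of_ord n)
            (fun x => M x) at_lo
            (fun (a : arrow lq) u =>
               if (@target lq a <= lo)%N then at_lo (target a)
               else amap M a u)) => //.
  exact: val_inj.
have w_lo : w lo = v.
  have <- : at_lo lo = v by rewrite /at_lo dfwith_in.
  suff : forall x : vertex lq, (x <= lo)%N -> w x = at_lo x by apply.
  move=> x.
  have [/codomP[a ->] le_lo|/w_min //] := boolP (x \in codom (@target lq)).
  by rewrite wE le_lo.
have w_step (a : arrow lq) : (lo <= @source lq a)%N ->
    w (target a) = amap M a (w (source a)).
  by move=> le_lo; rewrite wE leqNgt ltnS le_lo.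
have nz_lo : w lo != 0 by rewrite w_lo.
case: (@arg_maxnP _ lo (fun x => w x != 0) (@nat_of_ord n) nz_lo)
  => hi nz_hi hi_max.
have lo_hi : (lo <= hi)%N := hi_max lo nz_lo.
have w_above (x : vertex lq) : (hi < x)%N -> w x = 0.
  by move=> lt_x; apply/eqP; apply: contraTT lt_x => /hi_max; rewrite -leqNgt.
have [psi psi_hi] := dual_vector nz_hi.
pose at_hi (x : vertex lq) : 'Hom(M x, F^o) := dfwith (fun x => 0) psi x.
have [phi [phiE phi_max]] : exists phi : forall x : vertex lq, 'Hom(M x, F^o),
    (forall a : arrow lq,
       phi (source a) = if (hi <= @source lq a)%N then at_hi (source a)
                        else (phi (target a) \o amap M a)%VF) /\
    (forall x, x \notin codom (@source lq) -> phi x = at_hi x).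
  apply: (@section_along_arrows _ _ (@target lq) (@source lq)
            (fun x : 'I_n => n - x)%N (fun x => 'Hom(M x, F^o)) at_hi
            (fun (a : arrow lq) u =>
               if (hi <= @source lq a)%N then at_hi (source a)
               else (u \o amap M a)%VF)) => //.
    move=> x y /= e; apply: val_inj => /=.
    by have := ltn_ord x; have := ltn_ord y; lia.
  by move=> a /=; have := ltn_ord a; lia.
have phi_step (a : arrow lq) u : (@source lq a < hi)%N ->
    phi (source a) u = phi (target a) (amap M a u).
  by move=> lt_hi; rewrite phiE leqNgt lt_hi comp_lfunE.
have phi_hi : phi hi = psi.
  have <- : at_hi hi = psi by rewrite /at_hi dfwith_in.
  suff : forall x : vertex lq, (hi <= x)%N -> phi x = at_hi x by apply.
  move=> x.
  have [/codomP[a ->] hi_le|/phi_max //] := boolP (x \in codom (@source lq)).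
  by rewrite phiE hi_le.
have phi_w (x : vertex lq) : (lo <= x <= hi)%N -> phi x (w x) = 1.
  have [m] : exists m, m = (hi - x)%N by eexists.
  elim: m x => [|m IHm] x e /andP[lo_x x_hi].
    have -> : x = hi by apply: val_inj => /=; lia.
    by rewrite phi_hi.
  have lt_x : (x < n.-1)%N by have := ltn_ord hi; lia.
  have ex : x = @source lq (Ordinal lt_x) by exact: val_inj.
  rewrite ex in lo_x *; rewrite phi_step /=; last by lia.
  rewrite -w_step // IHm //=; first by rewrite subnS -e.
  by rewrite leqW //= -subn_gt0 -e.
exists lo, hi; split=> //.
pose s (x : vertex lq) : 'Hom(interval_rep lo hi x, M x) :=
  linfun (fun u => coef u *: w x).
pose g (x : vertex lq) : 'Hom(M x, interval_rep lo hi x) :=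
  linfun (fun u => const_mx (phi x u)).
have sE x u : s x u = coef u *: w x.
  by rewrite linfunE // => c u1 u2; rewrite coef_scalar scalerDl scalerA.
have gE x u : g x u = const_mx (phi x u).
  rewrite linfunE // => c u1 u2; rewrite linearP; apply/rowP => j.
  by rewrite !mxE.
apply: (@indecomposable_retract F lq M (interval_rep lo hi) s g) => //.
- apply: rep_homP => a u; rewrite !sE amap_interval linearZ /=.
  have /orP[src_in|/negbTE src_out] := orbN (lo <= @source lq a <= hi)%N;
    last first.
    rewrite [u]row_bool0 // coef0 scale0r.
    by rewrite const_mx0 coef0 scale0r.
  have /andP[lo_a _] := src_in; rewrite -w_step //.
  have /orP[tgt_in|tgt_out] := orbN (lo <= @target lq a <= hi)%N.
    by rewrite coef_const.
  by rewrite w_above ?scaler0 //; move: src_in tgt_out => /=; lia.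
- apply: rep_homP => a u; rewrite !gE amap_interval.
  have /orP[tgt_in|/negbTE tgt_out] := orbN (lo <= @target lq a <= hi)%N;
    last first.
    by rewrite [LHS]row_bool0 // [RHS]row_bool0.
  have /orP[ge_lo|] := orbN (lo <= @source lq a)%N; last first.
    rewrite -ltnNge => lt_lo.
    by rewrite (below _ u lt_lo) !linear0 !const_mx0 coef0 const_mx0.
  have src_in : (lo <= @source lq a <= hi)%N by move: ge_lo tgt_in => /=; lia.
  rewrite coef_const //; congr const_mx; symmetry; apply: phi_step.
  by move: tgt_in => /=; lia.
- move=> x u; rewrite sE gE linearZ /=.
  have /orP[x_in|/negbTE x_out] := orbN (lo <= x <= hi)%N; last first.
    by rewrite [u]row_bool0 // [LHS]row_bool0.
  by rewrite phi_w // [_ *: 1]mulr1 const_coef.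
- have [//] := interval_indecomposable lo_hi.
Qed.

End Linear.

(** * Modules over the Nakayama algebra *)

Lemma nakayama_iso (F : fieldType) n k i p (M N : rep F (linear_quiver n)) :
  rep_iso M N -> nakayama_module k i p M -> nakayama_module k i p N.
Proof.
move=> [f [f_bij fH]] M_nak l l_in x y w w_lab; apply/lfunP => v.
have [g _ gK] := f_bij x; rewrite -(gK v) -(rep_hom_path w _ fH).
by rewrite (M_nak l l_in _ _ _ w_lab) !lfunE /= linear0.
Qed.

(** Vertices are numbered from 0 for
    [lo] and [hi] but from 1 for [i], so the relation [l] runs from the vertex
    [i l - 1] to the vertex [i l + p l]. *)
Definition admissible k (i p : nat -> nat) (lo hi : nat) : bool :=
  all (fun l => (i l <= lo) || (hi < i l + p l))%N (iota 1 k).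

(** A path acts on an interval representation as a nonzero map exactly when the
    interval contains both of its ends. *)
Lemma nakayama_interval (F : fieldType) n k i p (lo hi : 'I_n) :
  (forall l, (1 <= l <= k)%N -> (1 <= i l)%N) ->
  nakayama_module k i p (interval_rep F n lo hi) <-> admissible k i p lo hi.
Proof.
move=> i_ge1; split=> [nak|/allP adm l l_in x y w w_lab].
  apply/allP => l; rewrite mem_iota add1n ltnS => l_in; have := i_ge1 l l_in.
  case: leqP => //= lo_lt _; rewrite ltnNge; apply/negP => le_hi.
  have hi_lt := ltn_ord hi.
  have x_lt : ((i l).-1 < n)%N by lia.
  have y_lt : (i l + p l < n)%N by lia.
  pose x : vertex (linear_quiver n) := Ordinal x_lt.
  pose y : vertex (linear_quiver n) := Ordinal y_lt.
  have [|w] := @linear_path n x y; first by rewrite /=; lia.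
  have x_in : (lo <= x <= hi)%N by rewrite /=; lia.
  have y_in : (lo <= y <= hi)%N by rewrite /=; lia.
  have w_lab : path_labels w = iota (i l) (p l).+1.
    have [_ ->] := path_labels_iota w; congr iota; rewrite /=; lia.
  have /andP[lo_x _] := x_in; have /andP[_ y_hi] := y_in.
  have /lfunP/(_ (const_mx 1)) := nak l l_in x y w w_lab.
  rewrite pmap_interval // lfunE /= coef_const // => /(congr1 (@coef F _)).
  by rewrite coef_const // coef0 => /eqP; rewrite oner_eq0.
apply/lfunP => u; rewrite lfunE /=.
have [le_xy] := path_labels_iota w; rewrite w_lab.
case e : (y - x)%N => [|m] // [ix].
move/(congr1 size); rewrite !size_iota => pm.
have /orP[lo_ge|hi_lt] : (i l <= lo)%N || (hi < i l + p l)%N.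
  by apply: adm; rewrite mem_iota; lia.
- by rewrite [u]row_bool0 ?linear0 //; lia.
- by rewrite [LHS]row_bool0 //; lia.
Qed.

(** * Counting the admissible intervals *)

Lemma card_ord_range n lo c :
  (c <= n)%N -> #|[set y : 'I_n | lo <= y < c]%N| = (c - lo)%N.
Proof.
move=> le_c; rewrite -sum1_card -[RHS]muln1 -sum_nat_const_nat.
rewrite (big_nat_widen _ _ _ _ _ le_c) (big_nat_widenl _ _ _ _ _ (leq0n lo)).
by rewrite big_mkord; apply: eq_bigl => y; rewrite inE andbC.
Qed.

Lemma sum_nat_rat s t : (s <= t)%N ->
  \sum_(s <= x < t) x%:R = t%:R * (t%:R - 1) / 2 - s%:R * (s%:R - 1) / 2 :> rat.
Proof.
move=> /subnK <-; elim: (t - s)%N => [|d IHd]; first by rewrite big_geq ?subrr.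
rewrite addSn big_nat_recr ?leq_addl //= IHd -[in RHS]natr1; by field.
Qed.

Section Count.
Variables (n k : nat) (i p : nat -> nat).
Hypotheses (n_gt0 : (0 < n)%N)
  (ip_le : forall l : nat, (1 <= l <= k)%N -> (i l + p l <= n - 1)%N)
  (i_incr : forall l m : nat, (1 <= l)%N -> (l < m)%N -> (m <= k)%N ->
     (i l < i m)%N)
  (ip_incr : forall l m : nat, (1 <= l)%N -> (l < m)%N -> (m <= k)%N ->
     (i l + p l < i m + p m)%N)
  (i_first : i 0%N = 0%N)
  (i_last : i k.+1 = n)
  (p_last : p k.+1 = 0%N).

Let i_mono l m : (l <= m <= k.+1)%N -> (i l <= i m)%N.
Proof.
move=> /andP[le_lm m_le]; have [->//|lt_lm] := eqVneq l m.
have [->|l_gt0] := posnP l; first by rewrite i_first.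
have [m_le_k|m_gt] := leqP m k; first by apply/ltnW/i_incr => //; lia.
have -> : m = k.+1 by lia.
have := ip_le (l := l); lia.
Qed.

Let ends_le l : (1 <= l <= k.+1)%N -> (i l + p l <= n)%N.
Proof.
have [->|ne] := eqVneq l k.+1; first by rewrite i_last p_last addn0.
by have := ip_le (l := l); lia.
Qed.

(** Earlier relations start too soon to lie in the interval, and later ones end
    after relation [l].  For [l = k + 1] the bound is [n], since then no
    relation starts late enough. *)
Lemma admissible_range l lo hi : (1 <= l <= k.+1)%N ->
  (i l.-1 <= lo < i l)%N -> (hi < n)%N ->
  admissible k i p lo hi = (hi < i l + p l)%N.
Proof.
move=> l_in /andP[lo_ge lo_lt] hi_n; apply/allP/idP => [adm|hi_lt m].
  have [e|ne] := eqVneq l k.+1; first by rewrite e i_last p_last addn0.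
  have := adm l; rewrite mem_iota [(i l <= lo)%N]leqNgt lo_lt; apply; lia.
rewrite mem_iota => m_in; have [lt_ml|le_lm] := ltnP m l.
  by rewrite (leq_trans _ lo_ge) // i_mono //; lia.
have [e|ne] := eqVneq l m; first by rewrite -e hi_lt orbT.
by rewrite (ltn_trans hi_lt) ?orbT // ip_incr //; lia.
Qed.

Lemma card_admissible :
  #|[set c : 'I_n * 'I_n | (c.1 <= c.2)%N && admissible k i p c.1 c.2]|%:R =
  \sum_(1 <= l < k.+2) ((i l)%:R - (i l.-1)%:R) * ((i l)%:R + (p l)%:R)
    - n%:R * (n%:R - 1) / 2 :> rat.
Proof.
pose ht lo := #|[set y : 'I_n | (lo <= y)%N && admissible k i p lo y]|.
have -> : #|[set c : 'I_n * 'I_n | (c.1 <= c.2)%N && admissible k i p c.1 c.2]|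
    = (\sum_(0 <= lo < n) ht lo)%N.
  rewrite big_mkord; under [RHS]eq_bigr do rewrite /ht -sum1_card.
  by rewrite -sum1_card pair_big_dep; apply: eq_bigl => c; rewrite !inE.
rewrite natr_sum -i_last.
(* The starts [lo] are grouped into the blocks [i l.-1 <= lo < i l]. *)
suff H m : (m <= k.+1)%N -> \sum_(0 <= lo < i m) (ht lo)%:R =
  \sum_(1 <= l < m.+1) ((i l)%:R - (i l.-1)%:R) * ((i l)%:R + (p l)%:R)
    - (i m)%:R * ((i m)%:R - 1) / 2 :> rat by exact: H.
elim: m => [_|m IHm m_lt].
  by rewrite i_first !big_geq // mul0r mul0r subr0.
have le_i : (i m <= i m.+1)%N by apply: i_mono; lia.
rewrite (big_cat_nat _ le_i) //= IHm ?(ltnW m_lt) // [in RHS]big_nat_recr //=.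
have -> : \sum_(i m <= lo < i m.+1) (ht lo)%:R =
    \sum_(i m <= lo < i m.+1) ((i m.+1)%:R + (p m.+1)%:R - lo%:R) :> rat.
  apply: eq_big_nat => lo lo_in; rewrite -natrD -natrB; last by lia.
  congr _%:R; rewrite -(card_ord_range (n := n)) ?ends_le //.
  apply: eq_card => y; rewrite !inE.
  by rewrite (@admissible_range m.+1) ?ltn_ord.
rewrite big_split /= sumrN sum_nat_rat // sumr_const_nat.
rewrite -[(_ + _) *+ _]mulr_natr natrB //.
ring.
Qed.

End Count.

Theorem theorem3p2 (F : closedFieldType) (n k : nat) (i p : nat -> nat)
  (n_ge3 : (3 <= n)%N)
  (i_ge1 : forall l : nat, (1 <= l <= k)%N -> (1 <= i l)%N)
  (p_ge1 : forall l : nat, (1 <= l <= k)%N -> (1 <= p l)%N)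
  (ip_le : forall l : nat, (1 <= l <= k)%N -> (i l + p l <= n - 1)%N)
  (i_incr : forall l m : nat, (1 <= l)%N -> (l < m)%N -> (m <= k)%N ->
     (i l < i m)%N)
  (ip_incr : forall l m : nat, (1 <= l)%N -> (l < m)%N -> (m <= k)%N ->
     (i l + p l < i m + p m)%N)
  (i_first : i 0%N = 0%N)
  (i_last : i k.+1 = n)
  (p_last : p k.+1 = 0%N) :
  exists N : nat,
    num_iso_classes
      (fun M : rep F (linear_quiver n) =>
         nakayama_module k i p M /\ indecomposable M) N /\
    N%:R = \sum_(1 <= l < k.+2)
             ((i l)%:R - (i l.-1)%:R) * ((i l)%:R + (p l)%:R)
           - n%:R * (n%:R - 1) / 2 :> rat.
Proof.
pose D := [set c : 'I_n * 'I_n | (c.1 <= c.2)%N && admissible k i p c.1 c.2].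
exists #|D|; split; last by apply: card_admissible => //; lia.
exists (fun s : 'I_#|D| =>
  let c : 'I_n * 'I_n := enum_val s in interval_rep F n c.1 c.2); split.
- move=> s; have := enum_valP s; rewrite inE => /andP[lo_hi adm].
  split; last exact: interval_indecomposable.
  exact/nakayama_interval.
- move=> s t; have := enum_valP s; have := enum_valP t.
  rewrite !inE => /andP[t_le _] /andP[s_le _] /interval_iso_eq[].
  + by rewrite s_le /=.
  + by rewrite t_le /=.
  move=> /val_inj e1 /val_inj e2; apply: enum_val_inj.
  by rewrite [LHS]surjective_pairing e1 e2 -surjective_pairing.
- move=> M [M_nak M_ind].
  have [lo [hi [lo_hi M_iso]]] := indecomposable_interval M_ind.
  have lh_in : (lo, hi) \in D.
    rewrite inE /= lo_hi /=.
    exact/(nakayama_interval F p lo hi i_ge1)/(nakayama_iso M_iso).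
  by exists (enum_rank_in lh_in (lo, hi)); rewrite enum_rankK_in.
Qed.
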